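(* Let $(\mathcal L,\ell=\sum_{i=0}^3\ell_i)$ be a curved $L_\infty$-algebra and $\pi$ a degree zero element of $\mathcal L$. Then $(\mathcal L,\varepsilon^\pi\ell)$ is a curved $L_\infty$-algebra.
   Context: A curved pre-$L_\infty$-algebra is a graded real vector space $\mathcal L=\bigoplus_{i\in\mathbb Z}\mathcal L_i$ with a family $\ell=\sum_{i\ge0}\ell_i$ of graded symmetric multilinear maps $\ell_i:\otimes^i\mathcal L\to\mathcal L$ of degree $1$ ($\ell_0\in\mathcal L_1$). It is a curved $L_\infty$-algebra if for all $n\ge0$ and homogeneous $X_1,\dots,X_n$, $$\sum_{i+j=n+1}\ \sum_{\sigma\in Sh(i,j-1)}\epsilon(\sigma)\,\ell_j(\ell_i(X_{\sigma(1)},\dots,X_{\sigma(i)}),X_{\sigma(i+1)},\dots,X_{\sigma(n)})=0,$$ where $i\ge0$, $j\ge1$, $Sh(i,j-1)$ is the set of $(i,j-1)$-unshuffles and $\epsilon(\sigma)$ is the graded commutative Koszul sign. For $\pi\in\mathcal L_0$ and $\ell=\sum_{i=0}^3\ell_i$ (that is, $\ell_i=0$ for $i\ge4$), the twisting $\varepsilon^\pi\ell=\sum_{i=0}^3(\varepsilon^\pi\ell)_i$ is given by $(\varepsilon^\pi\ell)_0=\ell_0-\ell_1(\pi)+\frac12\ell_2(\pi,\pi)-\frac16\ell_3(\pi,\pi,\pi)$, $(\varepsilon^\pi\ell)_1=\ell_1-\ell_2(\pi,\cdot)+\frac12\ell_3(\pi,\pi,\cdot)$, $(\varepsilon^\pi\ell)_2=\ell_2-\ell_3(\pi,\cdot,\cdot)$,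 $(\varepsilon^\pi\ell)_3=\ell_3$. *)

(* Defs.v *)
From HB Require Import structures.
From mathcomp Require Import all_boot all_order all_algebra all_fingroup.
From mathcomp Require Import reals.

Set Implicit Arguments.
Unset Strict Implicit.
Unset Printing Implicit Defensive.

Import Order.TTheory GRing.Theory Num.Theory.
Local Open Scope ring_scope.

Section CurvedLinfty.
Variables (R : realType) (V : lmodType R).

(* V is the internal direct sum of the subspaces L i, i ranging over int. *)
Definition is_graded (L : int -> submodClosed V) : Prop :=
  (forall v : V, exists (r : seq int) (x : int -> V),
     [/\ uniq r, forall i, x i \in L i & v = \sum_(i <- r) x i]) /\
  (forall (r : seq int) (x : int -> V),
     uniq r -> (forall i, x i \in L i) -> \sum_(i <- r) x i = 0 ->
     forall i, i \in r -> x i = 0).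

(* For l : brackets, the n-ary bracket is l n; the nullary one is a vector. *)
Definition brackets := forall n : nat, n.-tuple V -> V.

Definition set_tnth n (X : n.-tuple V) (k : 'I_n) (v : V) : n.-tuple V :=
  [tuple if m == k then v else tnth X m | m < n].

Definition perm_tuple n (X : n.-tuple V) (s : 'S_n) : n.-tuple V :=
  [tuple tnth X (s k) | k < n].

(* The sign with X_1 ... X_n = koszul d s * X_s(1) ... X_s(n) in the free      *)
(* graded commutative algebra, when X_k has degree d k: each inversion of s   *)
(* swaps one pair of factors.                                                 *)
Definition koszul n (d : 'I_n -> int) (s : 'S_n) : R :=
  \prod_(p : 'I_n * 'I_n | (p.1 < p.2)%N && (s p.2 < s p.1)%N)
    (-1) ^ (d (s p.1) * d (s p.2)).

Definition homogeneous (L : int -> submodClosed V) n (X : n.-tuple V)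
    (d : 'I_n -> int) : Prop :=
  forall k, tnth X k \in L (d k).

Definition multilinear (l : brackets) : Prop :=
  forall n (X : n.-tuple V) (k : 'I_n) (a : R) (u v : V),
    l n (set_tnth X k (a *: u + v)) =
    a *: l n (set_tnth X k u) + l n (set_tnth X k v).

Definition graded_symmetric (L : int -> submodClosed V) (l : brackets) : Prop :=
  forall n (X : n.-tuple V) (d : 'I_n -> int) (s : 'S_n),
    homogeneous L X d -> l n X = koszul d s *: l n (perm_tuple X s).

Definition degree_one (L : int -> submodClosed V) (l : brackets) : Prop :=
  forall n (X : n.-tuple V) (d : 'I_n -> int),
    homogeneous L X d -> l n X \in L (\sum_k d k + 1).

Record curved_preLinfty (L : int -> submodClosed V) (l : brackets) : Prop :=
  CurvedPreLinfty {
    preLinfty_graded : is_graded L;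
    preLinfty_multilinear : multilinear l;
    preLinfty_symmetric : graded_symmetric L l;
    preLinfty_degree : degree_one L l
  }.

(* The (i, n - i)-unshuffles: s is increasing on the positions below i and on *)
(* those from i on.                                                           *)
Definition unshuffle n (i : nat) (s : 'S_n) : bool :=
  [forall a : 'I_n, forall b : 'I_n,
     (a < b)%N && ((b < i)%N || (i <= a)%N) ==> (s a < s b)%N].

(* The outer bracket has arity j = n + 1 - i: its arguments are the inner     *)
(* bracket and the n - i remaining entries.                                   *)
Definition jacobiator (l : brackets) n (X : n.-tuple V) (d : 'I_n -> int) : V :=
  \sum_(i < n.+1) \sum_(s : 'S_n | unshuffle i s)
    koszul d s *:
      (let Y := perm_tuple X s in
       l _ (in_tuple (l _ (in_tuple (take i Y)) :: drop i Y))).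

Definition curved_Linfty (L : int -> submodClosed V) (l : brackets) : Prop :=
  curved_preLinfty L l /\
  forall n (X : n.-tuple V) (d : 'I_n -> int),
    homogeneous L X d -> jacobiator l X d = 0.

Definition twist (l : brackets) (w : V) : brackets := fun n =>
  match n return n.-tuple V -> V with
  | 0 => fun _ =>
      l 0%N [tuple] - l 1%N [tuple w] + 2^-1 *: l 2%N [tuple w; w]
      - 6^-1 *: l 3%N [tuple w; w; w]
  | 1 => fun X =>
      l 1%N X - l 2%N [tuple of w :: X] + 2^-1 *: l 3%N [tuple of w :: w :: X]
  | 2 => fun X => l 2%N X - l 3%N [tuple of w :: X]
  | 3 => fun X => l 3%N X
  | _ => fun _ => 0
  end.

End CurvedLinfty.

(* Main.v *)
Require Import Defs.
From mathcomp Require Import all_boot all_order all_algebra all_fingroup.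
From mathcomp Require Import reals boolp.

Set Implicit Arguments.
Unset Strict Implicit.
Unset Printing Implicit Defensive.

Import Order.TTheory GRing.Theory Num.Theory.
Local Open Scope ring_scope.

(** Inserting [w] in the first slot turns a family of brackets [l] into the
    family [D l], with [(D l)_n = l_(n+1)(w, -)].  The whole proof is that [D]
    is a derivation and that twisting is the exponential of [-D].

    Polarise the left-hand side of the Jacobi identity into an expression
    [jac a b] that uses the brackets [b] inside and the brackets [a] outside,
    so that the identity for [l] reads [jac l l = 0].  In
    [jac a b (w, X_1, ..., X_n)] each unshuffle sends [w] either to the inner
    bracket or to the outer one.  As [w] has degree 0 it moves past the other
    entries, and past the value of the inner bracket, without a sign; hence
    [jac a b (w, X) = jac (D a) b X + jac a (D b) X] (lemma [jac_cons]).
    Evaluating [jac l l] on [N] copies of [w] followed by [X] and iterating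
    this Leibniz rule gives, for every [N],
    [\sum_k 'C(N, k) jac (D^k l) (D^(N-k) l) X = 0]
    (lemma [jac_insert_binomial0]).

    If [l_n = 0] for [n > r] then [D^k l = 0] for [k > r], the exponential
    [\sum_k (-1)^k / k! D^k l] is a finite sum, and its Jacobi expression is,
    by bilinearity, the sum over [N] of [(-1)^N / N!] times the vanishing
    expressions above (lemma [exp_twist_curved_Linfty]).  The case [r = 3] is
    the twisting of the theorem (lemma [twistE]).  Multilinearity, symmetry and
    degree pass to [D l] because [w] has degree 0, and to linear
    combinations. *)

(** * Permutations with a marked position *)

Lemma lift_perm_inj n (i j : 'I_n.+1) : injective (lift_perm i j).
Proof.
move=> s t /permP est; apply/permP => k.
by apply: (@lift_inj _ j); rewrite -!(lift_perm_lift i) est.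
Qed.

Lemma lift_perm_exists n (s : 'S_n.+1) (i : 'I_n.+1) :
  exists t, s = lift_perm i (s i) t.
Proof.
have /fin_all_exists[f sE] (k : 'I_n) : exists k', s (lift i k) = lift (s i) k'.
  have /unlift_some[k' -> _] : s i != s (lift i k).
    by rewrite (inj_eq perm_inj) neq_lift.
  by exists k'.
have f_inj : injective f.
  move=> k1 k2 ek; apply: (@lift_inj _ i); apply: (@perm_inj _ s).
  by rewrite !sE ek.
exists (perm f_inj); apply/permP => k.
case: (unliftP i k) => [k' -> | ->]; last by rewrite lift_perm_id.
by rewrite lift_perm_lift permE sE.
Qed.

(** The permutations sending [i] to [j] are parametrised by the permutations of
    the remaining points; this is how the sums over unshuffles are split
    according to the position that receives the inserted entry. *)
Lemma big_lift_perm (T : Type) (idx : T) (op : Monoid.com_law idx) n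
    (i j : 'I_n.+1) (P : pred 'S_n.+1) (F : 'S_n.+1 -> T) :
  \big[op/idx]_(s | P s && (s i == j)) F s =
  \big[op/idx]_(t | P (lift_perm i j t)) F (lift_perm i j t).
Proof.
transitivity (\big[op/idx]_(s in lift_perm i j @: [set: 'S_n] | P s) F s).
  apply: eq_bigl => s; rewrite andbC; congr (_ && _).
  apply/eqP/imsetP => [sij | [t _ ->]]; last by rewrite lift_perm_id.
  by have [t st] := lift_perm_exists s i; exists t; rewrite ?inE // -sij.
rewrite big_imset_cond => [|s t _ _ /lift_perm_inj //].
by apply: eq_bigl => t; rewrite inE.
Qed.

Lemma ltn_lift n (k : 'I_n.+1) (a b : 'I_n) :
  (lift k a < lift k b)%N = (a < b)%N.
Proof. by rewrite !ltnNge leq_bump2. Qed.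

(** * Koszul signs and unshuffles *)

Lemma koszulE (R : realType) n (d : 'I_n -> int) (s : 'S_n) :
  koszul R d s = \prod_(a < n) \prod_(b < n)
    (if (a < b)%N && (s b < s a)%N then (-1) ^ (d (s a) * d (s b)) else 1).
Proof.
under eq_bigr do rewrite -big_mkcond /=.
by rewrite [RHS](pair_big_dep xpredT (fun a b => _) (fun a b => _)).
Qed.

(** An entry of degree 0 commutes with all others, so deleting it does not
    change the sign. *)
Lemma koszul_lift_perm (R : realType) n (d : 'I_n.+1 -> int) (i j : 'I_n.+1)
    (s : 'S_n) :
  d j = 0 ->
  koszul R d (lift_perm i j s) = koszul R (fun k => d (lift j k)) s.
Proof.
move=> dj0; rewrite !koszulE (bigD1_ord i) //= big1 => [|b _]; last first.
  by rewrite lift_perm_id dj0 mul0r expr0z if_same.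
rewrite mul1r; apply: eq_bigr => a _.
rewrite (bigD1_ord i) //= lift_perm_id dj0 mulr0 expr0z if_same mul1r.
by apply: eq_bigr => b _; rewrite !lift_perm_lift !ltn_lift.
Qed.

Lemma koszul1 (R : realType) n (d : 'I_n -> int) : koszul R d 1 = 1.
Proof.
rewrite /koszul big_pred0 // => p; rewrite !perm1.
by case: ltngtP.
Qed.

Lemma unshuffleP n i (s : 'S_n) :
  reflect (forall a b : 'I_n, (a < b)%N -> (b < i)%N || (i <= a)%N ->
             (s a < s b)%N)
          (unshuffle i s).
Proof.
apply: (iffP forallP) => [Ps a b ab abi | Ps a].
  by move/forallP/(_ b): (Ps a); rewrite ab abi.
by apply/forallP => b; apply/implyP => /andP[]; apply: Ps.
Qed.

(** The smallest value can be inserted into an unshuffle at the start of either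
    block: at position 0, which lengthens the first block, or at position [i],
    where the second block starts. *)
Lemma unshuffle_lift_perm n (k : 'I_n.+1) i j (t : 'S_n) :
  (forall a : 'I_n, (lift k a < i)%N = (a < j)%N) ->
  k = i :> nat \/ k = ord0 ->
  unshuffle i (lift_perm k ord0 t) = unshuffle j t.
Proof.
move=> ltij kP; have leij (a : 'I_n) : (i <= lift k a)%N = (j <= a)%N.
  by rewrite leqNgt ltij -leqNgt.
apply/unshuffleP/unshuffleP => Ps a b.
  have := Ps (lift k a) (lift k b).
  by rewrite !lift_perm_lift !ltn_lift ltij leij.
case: (unliftP k b) => [b' -> | ->].
  case: (unliftP k a) => [a' -> | ->]; last first.
    by rewrite lift_perm_id lift_perm_lift.
  by rewrite !lift_perm_lift !ltn_lift ltij leij; apply: Ps.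
case: kP => [-> ai | ->]; last by rewrite ltn0.
by rewrite ltnn leqNgt ai.
Qed.

(** Each block is increasing, so the smallest value can only occur at the start
    of a block.  The second alternative carries [0 < i]: when [i = 0] the first
    block is empty and position 0 belongs to the second one. *)
Lemma unshuffle_preim0 n i (s : 'S_n.+1) (k : 'I_n.+1) :
  unshuffle i s -> s k = ord0 -> 
  k = i :> nat \/ (0 < i)%N && (s ord0 == ord0).
Proof.
move=> /unshuffleP Ps sk0; have [lt_ki | lt_ik | ] := ltngtP k i; last by left.
  right; rewrite (leq_ltn_trans _ lt_ki) //= -[eqbRHS]sk0.
  rewrite (inj_eq perm_inj) eq_sym -val_eqE /= eqn0Ngt; apply/negP => k_gt0.
  by have := Ps ord0 k k_gt0; rewrite lt_ki sk0 ltn0 => /(_ isT).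
have := Ps (Ordinal (ltn_trans lt_ik (ltn_ord k))) k lt_ik.
by rewrite leqnn orbT sk0 ltn0 => /(_ isT).
Qed.

(** * Inserting a degree zero element into the brackets *)

Section Brackets.
Variables (R : realType) (V : lmodType R) (L : int -> submodClosed V).
Implicit Types (a b l : brackets V) (v w : V).

Definition cons_deg (e : int) n (d : 'I_n -> int) : 'I_n.+1 -> int :=
  fun k => oapp d e (unlift ord0 k).

Lemma cons_deg0 e n (d : 'I_n -> int) : cons_deg e d ord0 = e.
Proof. by rewrite /cons_deg unlift_none. Qed.

Lemma cons_degS e n (d : 'I_n -> int) k : cons_deg e d (lift ord0 k) = d k.
Proof. by rewrite /cons_deg liftK. Qed.

Lemma homogeneous_cons v e n (X : n.-tuple V) (d : 'I_n -> int) :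
  v \in L e -> homogeneous L X d ->
  homogeneous L [tuple of v :: X] (cons_deg e d).
Proof.
move=> ve hX k; case: (unliftP ord0 k) => [k' -> | ->].
  by rewrite tnthS cons_degS.
by rewrite tnth0 cons_deg0.
Qed.

Lemma koszul_cons n (d : 'I_n -> int) (i : 'I_n.+1) (s : 'S_n) :
  koszul R (cons_deg 0 d) (lift_perm i ord0 s) = koszul R d s.
Proof.
rewrite koszul_lift_perm ?cons_deg0 //; congr koszul.
by apply/funext => k; rewrite cons_degS.
Qed.

(** Blocks of a tuple obtained by [take] and [drop] have sizes that are only
    provably equal; comparing the underlying sequences avoids casts. *)
Lemma eq_bracket l m n (X : m.-tuple V) (Y : n.-tuple V) :
  X = Y :> seq V -> l m X = l n Y.
Proof.
move=> eXY; have emn : m = n by rewrite -(size_tuple X) eXY size_tuple.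
by case: n / emn in Y eXY *; congr (l m _); apply: val_inj.
Qed.

Lemma perm_tuple_cons w n (X : n.-tuple V) (i : 'I_n.+1) (s : 'S_n) :
  perm_tuple [tuple of w :: X] (lift_perm i ord0 s) =
    take i (perm_tuple X s) ++ w :: drop i (perm_tuple X s) :> seq V.
Proof.
set Y := perm_tuple X s; have le_in : (i <= n)%N by rewrite -ltnS.
have szi : size (take i Y) = i by rewrite size_takel ?(size_tuple Y).
apply: (@eq_from_nth _ w).
  by rewrite size_tuple size_cat /= szi size_drop (size_tuple Y) addnS subnKC.
move=> j; rewrite size_tuple => lt_jn; rewrite nth_cat szi.
rewrite -[j]/(nat_of_ord (Ordinal lt_jn)) -tnth_nth tnth_mktuple.
case: (unliftP i (Ordinal lt_jn)) => [k -> | ->]; last first.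
  by rewrite lift_perm_id tnth0 ltnn subnn.
have -> : tnth [tuple of w :: X] (lift_perm i ord0 s (lift i k)) = tnth Y k.
  by rewrite lift_perm_lift tnthS tnth_mktuple.
rewrite (tnth_nth w); have [le_ik | lt_ki] := leqP i k.
  have -> : lift i k = k.+1 :> nat by rewrite /= /bump le_ik.
  by rewrite ltnNge leqW //= subSn //= nth_drop subnKC.
have -> : lift i k = k :> nat by rewrite /= /bump leqNgt lt_ki.
by rewrite lt_ki nth_take.
Qed.

Lemma perm_tuple_cons0 w n (X : n.-tuple V) (s : 'S_n) :
  perm_tuple [tuple of w :: X] (lift_perm ord0 ord0 s) =
    [tuple of w :: perm_tuple X s].
Proof. by apply: val_inj; rewrite /= perm_tuple_cons take0 drop0. Qed.

Lemma set_tnth_cons v w n (X : n.-tuple V) (k : 'I_n) :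
  set_tnth [tuple of w :: X] (lift ord0 k) v = [tuple of w :: set_tnth X k v].
Proof.
apply: eq_from_tnth => m; rewrite tnth_mktuple.
case: (unliftP ord0 m) => [m' -> | ->]; last by rewrite !tnth0.
by rewrite !tnthS tnth_mktuple (inj_eq lift_inj).
Qed.

Lemma set_tnth_cons0 v w n (X : n.-tuple V) :
  set_tnth [tuple of w :: X] ord0 v = [tuple of v :: X].
Proof.
apply: eq_from_tnth => m; rewrite tnth_mktuple.
by case: (unliftP ord0 m) => [m' -> | ->]; rewrite ?tnthS ?tnth0.
Qed.

Definition insert w l : brackets V := fun n X => l n.+1 [tuple of w :: X].

Lemma insert_preLinfty w l :
  w \in L 0 -> curved_preLinfty L l -> curved_preLinfty L (insert w l).
Proof.
move=> hw [gr ml sy dg]; split => // n X.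
- by move=> k c u v; rewrite /insert -!set_tnth_cons ml.
- move=> d s hX; rewrite /insert.
  rewrite (sy _ _ _ (lift_perm ord0 ord0 s) (homogeneous_cons hw hX)).
  by rewrite koszul_cons perm_tuple_cons0.
- move=> d hX; have := dg _ _ _ (homogeneous_cons hw hX).
  rewrite big_ord_recl cons_deg0 add0r.
  by under eq_bigr do rewrite cons_degS.
Qed.

Lemma iter_insert_preLinfty w l k :
  w \in L 0 -> curved_preLinfty L l ->
  curved_preLinfty L (iter k (insert w) l).
Proof. by move=> hw hl; elim: k => //= k; apply: insert_preLinfty. Qed.

Definition lincomb r (c : nat -> R) (B : nat -> brackets V) : brackets V :=
  fun n X => \sum_(k < r) c k *: B k n X.

Lemma lincomb_preLinfty r c (B : nat -> brackets V) :
  is_graded L -> (forall k, curved_preLinfty L (B k)) ->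
  curved_preLinfty L (lincomb r c B).
Proof.
move=> gr hB; split => // n X; rewrite /lincomb.
- move=> k e u v; rewrite scaler_sumr -big_split /=; apply: eq_bigr => m _.
  by rewrite (preLinfty_multilinear (hB m)) scalerDr !scalerA mulrC.
- move=> d s hX; rewrite scaler_sumr; apply: eq_bigr => m _.
  by rewrite (preLinfty_symmetric (hB m) s hX) !scalerA mulrC.
- move=> d hX; apply: rpred_sum => m _; apply: rpredZ.
  exact: (preLinfty_degree (hB m)).
Qed.

Lemma bracket_lincomb_head a r (c : nat -> R) (u : nat -> V) n
    (X : n.-tuple V) :
  multilinear a ->
  a n.+1 [tuple of \sum_(k < r) c k *: u k :: X] =
    \sum_(k < r) c k *: a n.+1 [tuple of u k :: X].
Proof.
move=> ml; have lin e v1 v2 : a n.+1 [tuple of v1 + e *: v2 :: X] =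
    a n.+1 [tuple of v1 :: X] + e *: a n.+1 [tuple of v2 :: X].
  have := ml n.+1 [tuple of v1 :: X] ord0 e v2 v1.
  by rewrite !set_tnth_cons0 [e *: v2 + v1]addrC => ->; rewrite addrC.
elim: r => [|r IHr].
  rewrite !big_ord0; apply: (addIr (1 *: a n.+1 [tuple of 0 :: X])).
  by rewrite -lin scaler0 addr0 add0r scale1r.
by rewrite [RHS]big_ord_recr /= -IHr -lin big_ord_recr.
Qed.

Lemma bracket_head0 a n (X : n.-tuple V) :
  multilinear a -> a n.+1 [tuple of 0 :: X] = 0.
Proof.
by move/(bracket_lincomb_head 0 (fun=> 0) (fun=> 0) X); rewrite !big_ord0.
Qed.

(** The permutation exchanging the first two entries is the one that inserts
    [w] at position 1 into the identity, so its Koszul sign is 1. *)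
Lemma bracket_head_swap a v e w n (X : n.-tuple V) (d : 'I_n -> int) :
  graded_symmetric L a -> v \in L e -> w \in L 0 -> homogeneous L X d ->
  a n.+2 [tuple of v :: w :: X] = a n.+2 [tuple of w :: v :: X].
Proof.
move=> sy hv hw hX.
have hY := homogeneous_cons hw (homogeneous_cons hv hX).
rewrite [RHS](sy _ _ _ (lift_perm (lift ord0 ord0) ord0 1%g) hY).
rewrite koszul_cons koszul1 scale1r; apply: eq_bracket.
have perm1E : perm_tuple [tuple of v :: X] 1%g = [tuple of v :: X].
  by apply: eq_from_tnth => k; rewrite tnth_mktuple perm1.
by rewrite perm_tuple_cons perm1E /= take0 drop0.
Qed.

(** * The Jacobi expression as a bilinear form *)

Definition jac a b n (X : n.-tuple V) (d : 'I_n -> int) : V :=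
  \sum_(i < n.+1) \sum_(s : 'S_n | unshuffle i s)
    koszul R d s *:
      (let Y := perm_tuple X s in
       a _ [tuple of b _ (in_tuple (take i Y)) :: in_tuple (drop i Y)]).

Lemma jacobiatorE l n (X : n.-tuple V) (d : 'I_n -> int) :
  jacobiator l X d = jac l l X d.
Proof.
apply: eq_bigr => i _; apply: eq_bigr => s _; congr (_ *: _).
exact: eq_bracket.
Qed.

Lemma jac_lincomb r c (B : nat -> brackets V) n (X : n.-tuple V)
    (d : 'I_n -> int) :
  (forall k, multilinear (B k)) ->
  jac (lincomb r c B) (lincomb r c B) X d =
    \sum_(k < r) \sum_(m < r) (c k * c m) *: jac (B k) (B m) X d.
Proof.
move=> ml; rewrite /jac.
under [RHS]eq_bigr => k _ do
  (under eq_bigr => m _ do rewrite scaler_sumr; rewrite exchange_big /=).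
rewrite exchange_big; apply: eq_bigr => i _ /=.
under [RHS]eq_bigr => k _ do
  (under eq_bigr => m _ do rewrite scaler_sumr; rewrite exchange_big /=).
rewrite exchange_big; apply: eq_bigr => s _ /=.
rewrite scaler_sumr; apply: eq_bigr => k _.
rewrite (bracket_lincomb_head _ _ (fun m => B m _ _)) // !scaler_sumr.
by apply: eq_bigr => m _; rewrite !scalerA -mulrA mulrC.
Qed.

(** An element of degree 0 moves past any homogeneous one without a sign, so it
    is enough to know that some degree exists for the inner bracket. *)
Lemma degree_one_homogeneous b i n (X : n.-tuple V) (d : 'I_n -> int) :
  degree_one L b -> homogeneous L X d ->
  exists e, b _ (in_tuple (take i X)) \in L e.
Proof.
move=> dg hX.
have /fin_all_exists[e he] (k : 'I_(size (take i X))) :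
    exists e, tnth (in_tuple (take i X)) k \in L e.
  have /mem_take/tnthP[m ->] := mem_tnth k (in_tuple (take i X)).
  by exists (d m).
by exists (\sum_k e k + 1); apply: dg.
Qed.

Lemma homogeneous_drop i n (X : n.-tuple V) (d : 'I_n -> int) :
  homogeneous L X d -> exists e, homogeneous L (in_tuple (drop i X)) e.
Proof.
move=> hX.
have /fin_all_exists[e he] (k : 'I_(size (drop i X))) :
    exists e, tnth (in_tuple (drop i X)) k \in L e.
  have /mem_drop/tnthP[m ->] := mem_tnth k (in_tuple (drop i X)).
  by exists (d m).
by exists e.
Qed.

Lemma homogeneous_perm n (X : n.-tuple V) (d : 'I_n -> int) (s : 'S_n) :
  homogeneous L X d -> homogeneous L (perm_tuple X s) (d \o s).
Proof. by move=> hX k; rewrite tnth_mktuple; apply: hX. Qed.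

(** The Leibniz rule.  The permutations with [w] in a nonempty inner block,
    selected by [inner], give the second summand; those with [w] at the start
    of the outer block give the first one, once [w] has been exchanged with the
    value of the inner bracket. *)
Lemma jac_cons a b w n (X : n.-tuple V) (d : 'I_n -> int) :
  graded_symmetric L a -> degree_one L b -> w \in L 0 -> homogeneous L X d ->
  jac a b [tuple of w :: X] (cons_deg 0 d) =
    jac (insert w a) b X d + jac a (insert w b) X d.
Proof.
move=> sy dg hw hX; rewrite {1}/jac.
pose inner i (s : 'S_n.+1) := (0 < i)%N && (s ord0 == ord0).
under eq_bigr => i _ do rewrite (bigID (inner i)) /=.
rewrite big_split [LHS]addrC /=; congr (_ + _).
  (* For i = n + 1 the outer block is empty and w is always inside. *)
  rewrite big_ord_recr /= [X in _ + X]big_pred0 ?addr0 => [|s]; last first.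
    apply/negP => /andP[us /negP[]].
    case: (unshuffle_preim0 us (permKV s ord0)) => // e.
    by have := ltn_ord (s^-1%g ord0); rewrite e ltnn.
  apply: eq_bigr => i _.
  transitivity (\sum_(s : 'S_n.+1 | unshuffle i s && (s i == ord0))
    koszul R (cons_deg 0 d) s *: a _ [tuple of
      b _ (in_tuple (take i (perm_tuple [tuple of w :: X] s)))
      :: in_tuple (drop i (perm_tuple [tuple of w :: X] s))]).
    apply: eq_bigl => s; apply: andb_id2l => us; apply/idP/eqP.
      case: (unshuffle_preim0 us (permKV s ord0)) => [/ord_inj <- _ | ].
        by rewrite permKV.
      by rewrite -/(inner i s) => ->.
    move=> si0; apply/negP => /andP[i_gt0 /eqP s00].
    by have /perm_inj i0 := etrans si0 (esym s00); rewrite i0 in i_gt0.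
  rewrite big_lift_perm; apply: eq_big => [t | t _].
    apply: unshuffle_lift_perm; last by left.
    move=> k; rewrite /= /bump.
    by case: (leqP i k) => ik; rewrite ?add0n // ltnNge leqW.
  rewrite koszul_cons; congr (_ *: _) => /=.
  set Y := perm_tuple X t.
  have szi : size (take i Y) = i.
    by rewrite size_takel // (size_tuple Y) -ltnS.
  have hY := homogeneous_perm t hX.
  have [e be] := degree_one_homogeneous i dg hY.
  have [e' hD] := homogeneous_drop i hY.
  rewrite /insert -(bracket_head_swap sy be hw hD); apply: eq_bracket => /=.
  congr (_ :: _).
    by apply: eq_bracket; rewrite /= perm_tuple_cons take_size_cat.
  by rewrite perm_tuple_cons drop_size_cat.
(* For i = 0 the inner block is empty and cannot contain w. *)
rewrite big_ord_recl big_pred0 ?add0r => [|s]; last by rewrite andbF.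
apply: eq_bigr => i _; rewrite big_lift_perm; apply: eq_big => [t | t _].
  by apply: unshuffle_lift_perm; last by right.
rewrite koszul_cons; congr (_ *: _).
apply: eq_bracket; congr (_ :: _); first apply: eq_bracket.
  by rewrite /= perm_tuple_cons take0 drop0.
by rewrite /= perm_tuple_cons take0 drop0.
Qed.

End Brackets.

(** * Finite double sums *)

Lemma sum_ord_widen0 (V : nmodType) p q (F : nat -> V) :
  (p <= q)%N -> (forall k, (p <= k)%N -> F k = 0) ->
  \sum_(k < p) F k = \sum_(k < q) F k.
Proof.
move=> le_pq F0; rewrite (big_ord_widen q F le_pq) big_mkcond /=.
by apply: eq_bigr => k _; case: ltnP => // /F0.
Qed.

Lemma sum_antidiagonals (V : nmodType) M (G : nat -> nat -> V) :
  \sum_(N < M) \sum_(k < N.+1) G k (N - k)%N =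
  \sum_(k < M) \sum_(m < M - k) G k m.
Proof.
elim: M => [|M IHM]; first by rewrite !big_ord0.
rewrite big_ord_recr /= {}IHM !big_ord_recr /= subnn subSnn big_ord1 addrA.
congr (_ + _); rewrite -big_split; apply: eq_bigr => k _ /=.
by rewrite subSn ?big_ord_recr // ltnW.
Qed.

(** * Twisting as an exponential *)

Section Twist.
Variables (R : realType) (V : lmodType R) (L : int -> submodClosed V).
Implicit Types (l : brackets V) (w : V).

(** The left-hand side is the [N]-th derivative of [jac l l], that is, its
    value on [N] copies of [w] followed by [X].  The induction applies the
    hypothesis to [w :: X] and expands by the Leibniz rule and Pascal's
    rule. *)
Lemma jac_insert_binomial0 l w N n (X : n.-tuple V) (d : 'I_n -> int) :
  curved_Linfty L l -> w \in L 0 -> homogeneous L X d ->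
  \sum_(k < N.+1) 'C(N, k)%:R *:
    jac (iter k (insert w) l) (iter (N - k) (insert w) l) X d = 0.
Proof.
move=> [pl Jl] hw; elim: N n X d => [|N IHN] n X d hX.
  by rewrite big_ord1 bin0 scale1r -jacobiatorE Jl.
have := IHN _ _ _ (homogeneous_cons hw hX).
pose T k m := jac (iter k (insert w) l) (iter m (insert w) l) X d.
rewrite (eq_bigr (fun k : 'I_N.+1 => 'C(N, k)%:R *: T k.+1 (N - k)%N +
    'C(N, k)%:R *: T k (N - k).+1)) => [|k _]; last first.
  rewrite -scalerDr (jac_cons (L := L)) //.
    exact: preLinfty_symmetric (iter_insert_preLinfty _ hw pl).
  exact: preLinfty_degree (iter_insert_preLinfty _ hw pl).
rewrite big_split /= => IH; rewrite -[RHS]IH.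
rewrite (eq_bigr (fun k : 'I_N.+2 => 'C(N.+1, k)%:R *: T k (N.+1 - k)%N)) //.
rewrite big_ord_recl.
rewrite (eq_bigr (fun k : 'I_N.+1 => 'C(N, k.+1)%:R *: T k.+1 (N - k)%N +
    'C(N, k)%:R *: T k.+1 (N - k)%N)) => [|k _]; last first.
  by rewrite -scalerDl -natrD -binS lift0.
rewrite big_split /= addrA addrC; congr (_ + _).
rewrite [in RHS]big_ord_recl !bin0 !subn0; congr (_ + _).
rewrite big_ord_recr /= bin_small // scale0r addr0.
by apply: eq_bigr => k _; rewrite /bump add1n subnSK.
Qed.

Definition exp_coef k : R := (-1) ^+ k / k`!%:R.

(** The multiplication rule of the exponential series. *)
Lemma exp_coefM k m :
  exp_coef k * exp_coef m = exp_coef (k + m) * 'C(k + m, k)%:R.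
Proof.
have := bin_fact (leq_addr m k); rewrite addKn /exp_coef => <-.
have fact_neq0 p : p`!%:R != 0 :> R by rewrite pnatr_eq0 -lt0n fact_gt0.
have bin_neq0 : 'C(k + m, k)%:R != 0 :> R.
  by rewrite pnatr_eq0 -lt0n bin_gt0 leq_addr.
by rewrite exprD !natrM !invfM mulrACA -[RHS]mulrA [_^-1 * _ * _]mulrC mulVKf.
Qed.

Definition exp_twist r l w : brackets V :=
  lincomb r exp_coef (fun k => iter k (insert w) l).

Lemma iter_insert0 l w r k n (X : n.-tuple V) :
  (forall n (X : n.-tuple V), (r < n)%N -> l n X = 0) -> (r < k + n)%N ->
  iter k (insert w) l n X = 0.
Proof.
move=> lr; elim: k n X => [|k IHk] n X; first exact: lr.
by rewrite addSnnS => /IHk; apply.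
Qed.

(** Only finitely many products [T k m] are nonzero, all of them with
    [k + m <= 2r]; the square [k, m <= r] can therefore be replaced by the
    triangle [k + m <= 2r], whose antidiagonals vanish by
    [jac_insert_binomial0]. *)
Lemma exp_twist_curved_Linfty l w r :
  curved_Linfty L l ->
  (forall n (X : n.-tuple V), (r < n)%N -> l n X = 0) ->
  w \in L 0 -> curved_Linfty L (exp_twist r.+1 l w).
Proof.
move=> hl lr hw; have pl k := iter_insert_preLinfty k hw hl.1.
split; first by apply: lincomb_preLinfty => //; apply: preLinfty_graded hl.1.
move=> n X d hX; rewrite jacobiatorE jac_lincomb => [|k]; last first.
  exact: preLinfty_multilinear (pl k).
pose T k m := jac (iter k (insert w) l) (iter m (insert w) l) X d.
have D0 k : (r < k)%N -> forall n (Y : n.-tuple V), iter k (insert w) l n Y = 0.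
  by move=> rk p Y; apply: iter_insert0 lr _; apply: ltn_addr.
have Tl k m : (r < k)%N -> T k m = 0.
  move=> rk; apply: big1 => i _; apply: big1 => s _.
  by rewrite /= D0 // scaler0.
have Tr k m : (r < m)%N -> T k m = 0.
  move=> rm; apply: big1 => i _; apply: big1 => s _.
  rewrite /= (D0 m) // bracket_head0 ?scaler0 //.
  exact: preLinfty_multilinear (pl k).
pose G k m := (exp_coef k * exp_coef m) *: T k m.
transitivity (\sum_(k < (r + r).+1) \sum_(m < (r + r).+1 - k) G k m).
  rewrite (@sum_ord_widen0 _ _ (r + r).+1 (fun k => \sum_(m < r.+1) G k m)).
  - apply: eq_bigr => k _; case: (leqP k r) => [kr | rk].
      apply: sum_ord_widen0 => [|m rm]; last by rewrite /G Tr ?scaler0.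
      by rewrite subSn ?ltnS ?leq_subRL ?leq_add2r // (leq_trans kr) ?leq_addr.
    by rewrite !big1 // => m _; rewrite /G Tl ?scaler0.
  - by rewrite ltnS leq_addr.
  - by move=> k rk; rewrite big1 // => m _; rewrite /G Tl ?scaler0.
rewrite -sum_antidiagonals big1 // => N _.
rewrite -[RHS](scaler0 _ (exp_coef N)).
rewrite -[X in _ = _ *: X](jac_insert_binomial0 N hl hw hX).
rewrite scaler_sumr; apply: eq_bigr => k _.
have le_kN : (k <= N)%N by rewrite -ltnS.
by rewrite /G exp_coefM subnKC // scalerA.
Qed.

Lemma twistE l w :
  (forall n (X : n.-tuple V), (3 < n)%N -> l n X = 0) ->
  twist l w = exp_twist 4 l w.
Proof.
move=> l3; apply: functional_extensionality_dep => n; apply/funext => X.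
have D0 k : (3 < k + n)%N -> iter k (insert w) l n X = 0.
  exact: iter_insert0 l3.
have e0 : exp_coef 0 = 1 by rewrite /exp_coef expr0 divr1.
have e1 : exp_coef 1 = -1 by rewrite /exp_coef expr1 divr1.
have e2 : exp_coef 2 = 2^-1 by rewrite /exp_coef sqrrN expr1n div1r.
have e3 : exp_coef 3 = - 6^-1.
  by rewrite /exp_coef exprS sqrrN expr1n mulr1 mulN1r.
rewrite /exp_twist /lincomb !big_ord_recr big_ord0 /= add0r e0 e1 e2 e3.
rewrite scale1r scaleN1r scaleNr.
have D1 := D0 1%N; have D2 := D0 2%N; have D3 := D0 3%N.
case: n X D0 D1 D2 D3 => [|[|[|[|n]]]] X D0 /= D1 D2 D3.
- by rewrite /twist; congr (_ - _ + _ *: _ - _ *: _);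
    apply: eq_bracket; rewrite /= tuple0.
- by rewrite D3 // scaler0 subr0.
- by rewrite D3 // D2 // !scaler0 subr0 addr0.
- by rewrite D3 // D2 // D1 // !scaler0 !subr0 addr0.
by rewrite D3 // D2 // D1 // l3 // !scaler0 !subr0 addr0.
Qed.

End Twist.

Theorem proposition6p5 (R : realType) (V : lmodType R)
    (L : int -> submodClosed V) (l : brackets V) (w : V)
    (hl : curved_Linfty L l)
    (hl3 : forall (n : nat) (X : n.-tuple V), (3 < n)%N -> l n X = 0)
    (hw : w \in L 0) :
  curved_Linfty L (twist l w).
Proof. by rewrite twistE //; apply: exp_twist_curved_Linfty. Qed.
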